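(* Let $f$ and $g$ be functions on $(0,\infty)$. If the integrals involved converge absolutely, then the following Parseval-Goldstein type relations hold true: $$\int_{0}^{\infty}\mathscr{L}_{2}\{f(x);y\}\,\mathscr{L}_{2}\{g(u);y\}\,dy=\frac{\sqrt{\pi}}{2}\int_{0}^{\infty}x\,f(x)\,\mathscr{G}\{u\,g(u);x\}\,dx,$$ $$\int_{0}^{\infty}\mathscr{L}_{2}\{f(x);y\}\,\mathscr{L}_{2}\{g(u);y\}\,dy=\frac{\sqrt{\pi}}{2}\int_{0}^{\infty}u\,g(u)\,\mathscr{G}\{x\,f(x);u\}\,du,$$ and $$\int_{0}^{\infty}x\,f(x)\,\mathscr{G}\{u\,g(u);x\}\,dx=\int_{0}^{\infty}u\,g(u)\,\mathscr{G}\{x\,f(x);u\}\,du.$$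
   Context: For a function $f$ on $(0,\infty)$ and $y>0$, the $\mathscr{L}_2$-transform is $$\mathscr{L}_{2}\{f(x);y\}=\int_0^\infty x\,\exp(-x^{2}y^{2})\,f(x)\,dx,$$ and the Glasser transform is $$\mathscr{G}\{f(x);y\}=\int_{0}^{\infty}\frac{f(x)}{\sqrt{x^{2}+y^{2}}}\,dx.$$ In $\mathscr{L}_2\{g(u);y\}$ and $\mathscr{G}\{u\,g(u);x\}$ the variable of integration is $u$. *)

(* Defs.v *)
From HB Require Import structures.
From mathcomp Require Import all_boot all_order all_algebra.
From mathcomp Require Import all_classical all_reals all_analysis.

Set Implicit Arguments.
Unset Strict Implicit.
Unset Printing Implicit Defensive.

Import Order.TTheory GRing.Theory Num.Theory.
Import numFieldNormedType.Exports.

Local Open Scope classical_set_scope.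
Local Open Scope ring_scope.

(* A function on (0, +oo) is encoded as a total function R -> R; its values
   outside `]0, +oo[ are never used. *)

Definition L2_integrand (R : realType) (f : R -> R) (y x : R) : R :=
  x * expR (- (x ^+ 2 * y ^+ 2)) * f x.

(* [\int[_]_(_ in _) _] in ring_scope is the real-valued [Rintegral], which is
   the actual integral only when the integrand is integrable. *)
Definition L2_transform (R : realType) (f : R -> R) (y : R) : R :=
  \int[@lebesgue_measure R]_(x in `]0, +oo[) L2_integrand f y x.

Definition glasser_integrand (R : realType) (f : R -> R) (y x : R) : R :=
  f x / Num.sqrt (x ^+ 2 + y ^+ 2).

Definition glasser_transform (R : realType) (f : R -> R) (y : R) : R :=
  \int[@lebesgue_measure R]_(x in `]0, +oo[) glasser_integrand f y x.

(* Integrability over (0, +oo), i.e. measurability together with absolute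
   convergence of the integral. *)
Definition abs_convergent (R : realType) (h : R -> R) : Prop :=
  (@lebesgue_measure R).-integrable `]0, +oo[ (EFin \o h).

(* Main.v *)
(* The product of exp(-x^2 y^2) and exp(-u^2 y^2) is a Gaussian in y whose
   integral over (0, +oo) is (sqrt pi / 2) / sqrt(x^2 + u^2), the kernel of the
   Glasser transform. For fixed x > 0, Fubini in (y, u) therefore gives
     int exp(-x^2 y^2) L2{g; y} dy = (sqrt pi / 2) G{u g(u); x},
   and Fubini in (x, y) applied to x f(x) exp(-x^2 y^2) L2{g; y} gives the first
   identity. The second one is the first with f and g exchanged. *)

Require Import Defs.
From HB Require Import structures.
From mathcomp Require Import all_boot all_order all_algebra.
From mathcomp Require Import all_classical all_reals all_analysis.
From mathcomp Require Import measurable_realfun ring.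

Set Implicit Arguments.
Unset Strict Implicit.
Unset Printing Implicit Defensive.

Import Order.TTheory GRing.Theory Num.Theory.
Import numFieldNormedType.Exports.

Local Open Scope classical_set_scope.
Local Open Scope ring_scope.

(** * Fubini's theorem for real-valued integrals on a rectangle *)

Lemma EFin_Rintegral d (T : measurableType d) (R : realType)
    (mu : {measure set T -> \bar R}) (D : set T) (f : T -> R) :
  measurable D -> mu.-integrable D (EFin \o f) ->
  (\int[mu]_(x in D) f x)%:E = (\int[mu]_(x in D) (f x)%:E)%E.
Proof. by move=> mD fint; rewrite fineK//; exact: integrable_fin_num fint. Qed.

(** Integrability of every section, not just of almost every one, makes each inner real-valued
    integral agree with the extended one. The integrability conjunct lets later arguments extract
    measurability and pull constants out of the outer integral. *)
Lemma Rintegral_Fubini d1 d2 (T1 : measurableType d1) (T2 : measurableType d2)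
    (R : realType) (m1 : {sigma_finite_measure set T1 -> \bar R})
    (m2 : {sigma_finite_measure set T2 -> \bar R})
    (D1 : set T1) (D2 : set T2) (f : T1 -> T2 -> R) :
  measurable D1 -> measurable D2 ->
  measurable_fun (D1 `*` D2) (fun z => f z.1 z.2) ->
  (forall x, D1 x -> m2.-integrable D2 (EFin \o f x)) ->
  (forall y, D2 y -> m1.-integrable D1 (EFin \o f ^~ y)) ->
  (\int[m2]_(y in D2) \int[m1]_(x in D1) `|f x y|%:E < +oo)%E ->
  m1.-integrable D1 (EFin \o fun x => \int[m2]_(y in D2) f x y) /\
  \int[m1]_(x in D1) \int[m2]_(y in D2) f x y =
  \int[m2]_(y in D2) \int[m1]_(x in D1) f x y.
Proof.
move=> mD1 mD2 mf if1 if2 foo.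
(* Extension by zero off the rectangle reduces the claim to Fubini on the whole product space. *)
pose F := (EFin \o fun z => f z.1 z.2) \_ (D1 `*` D2).
have FE x y : F (x, y) = if (x \in D1) && (y \in D2) then (f x y)%:E else 0%E.
  by rewrite /F patchE in_setX.
have mF : measurable_fun [set: T1 * T2] F.
  by apply/(measurable_restrictT _ (measurableX mD1 mD2)); exact/measurable_EFinP.
have FxE x : (\int[m2]_y F (x, y))%E =
    ((EFin \o fun x => \int[m2]_(y in D2) f x y) \_ D1) x.
  rewrite patchE; have [xD1|xD1] := boolP (x \in D1).
    rewrite /= EFin_Rintegral//; last exact/if1/set_mem.
    rewrite integral_mkcond; apply: eq_integral => y _.
    by rewrite FE xD1 patchE.
  by rewrite integral0_eq// => y _; rewrite FE (negbTE xD1).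
have FyE y : (\int[m1]_x F (x, y))%E =
    ((EFin \o fun y => \int[m1]_(x in D1) f x y) \_ D2) y.
  rewrite patchE; have [yD2|yD2] := boolP (y \in D2).
    rewrite /= EFin_Rintegral//; last exact/if2/set_mem.
    rewrite integral_mkcond; apply: eq_integral => x _.
    by rewrite FE yD2 andbT patchE.
  by rewrite integral0_eq// => x _; rewrite FE (negbTE yD2) andbF.
(* By Tonelli, one finite iterated integral of the absolute value is enough. *)
have iF : (m1 \x m2)%E.-integrable [set: T1 * T2] F.
  apply/integrable21ltyP => //; move: foo; congr (_ < _)%E.
  rewrite integral_mkcond; apply: eq_integral => y _.
  rewrite patchE; have [yD2|yD2] := boolP (y \in D2).
    rewrite integral_mkcond; apply: eq_integral => x _.
    by rewrite FE yD2 andbT patchE; case: ifP => //; rewrite abse0.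
  by rewrite integral0_eq// => x _; rewrite FE (negbTE yD2) andbF abse0.
split.
  apply/integrable_mkcond => //.
  rewrite (_ : _ \_ _ = fubini_F m2 F); first exact: integrable_fubini_F.
  by apply/funext => x; rewrite /fubini_F FxE.
rewrite /Rintegral; congr fine.
rewrite integral_mkcond [RHS]integral_mkcond.
transitivity (\int[m1]_x \int[m2]_y F (x, y))%E.
  by apply: eq_integral => x _; rewrite FxE.
by rewrite (Fubini iF); apply: eq_integral => y _; rewrite FyE.
Qed.

(** * Constant multiples and the scaled Gaussian integral *)

Lemma integrable_EFinZl d (T : measurableType d) (R : realType)
    (mu : {measure set T -> \bar R}) (D : set T) (k : R) (f : T -> R) :
  measurable D -> mu.-integrable D (EFin \o f) ->
  mu.-integrable D (EFin \o fun x => k * f x).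
Proof. by move=> mD /(integrableZl mD k); exact: eq_integrable. Qed.

Lemma integral0y_gauss_scale (R : realType) (a : R) : 0 < a ->
  (\int[@lebesgue_measure R]_(y in `]0%R, +oo[) (expR (- (a * y) ^+ 2))%:E)%E =
  (Num.sqrt pi / 2 / a)%:E.
Proof.
move=> a0.
have ca : continuous (fun y : R => expR (- (a * y) ^+ 2)).
  move=> y; apply: (@continuous_comp _ _ _ ( *%R a) (@gauss_fun R)).
    exact: mulrl_continuous.
  exact: continuous_gauss_fun.
have ma : measurable_fun setT (fun y : R => expR (- (a * y) ^+ 2)).
  exact: continuous_measurable_fun.
(* The substitution rule lives on the closed half-line; the added endpoint is a null set. *)
rewrite integral_itv_obnd_cbnd; last first.
  by apply/measurable_EFinP; exact: measurable_funTS.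
have derM : (( *%R a)^`())%classic = cst a :> (R -> R).
  by apply/funext => z; rewrite derive1Ml// derive1_id mulr1.
have sub : (Num.sqrt pi / 2)%:E = (a%:E * \int[@lebesgue_measure R]_(y in
    `[0%R, +oo[) (expR (- (a * y) ^+ 2))%:E)%E.
  rewrite -integral0y_gauss.
  have := @increasing_ge0_integration_by_substitutiony R ( *%R a) gauss_fun 0.
  rewrite mulr0 derM => ->.
  - under eq_integral do rewrite fctE/= EFinM muleC.
    rewrite ge0_integralZl//=.
    + by apply/measurable_EFinP; exact: measurable_funTS.
    + by move=> x _; rewrite lee_fin expR_ge0.
    + by rewrite lee_fin ltW.
  - by move=> x y _ _; rewrite ltr_pM2l.
  - by move=> x _; exact: cvg_cst.
  - exact: is_cvg_cst.
  - exact: is_cvg_cst.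
  - split => [x _|]; first by [].
    by apply: cvg_at_right_filter; exact: mulrl_continuous.
  - exact: gt0_cvgMry.
  - by apply: continuous_subspaceT; exact: continuous_gauss_fun.
  - by move=> x _; exact: gauss_fun_ge0.
by rewrite EFinM sub muleAC -EFinM divff ?mul1e ?gt_eqF.
Qed.

(** * The Gaussian kernel and joint measurability of the integrands *)

Definition gauss_kernel (R : realType) (x y : R) : R :=
  expR (- (x ^+ 2 * y ^+ 2)).

Section parseval_goldstein.
Variable R : realType.
Local Notation mu := (@lebesgue_measure R).
Local Notation P := ([set` `]0%R, +oo[%O] : set R).
Local Notation K := (@gauss_kernel R).
Implicit Types f g h : R -> R.

Lemma gauss_kernel_gt0 x y : 0 < K x y.
Proof. exact: expR_gt0. Qed.

Lemma L2_integrandE f y x : L2_integrand f y x = x * f x * K x y.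
Proof. by rewrite /L2_integrand mulrAC. Qed.

Lemma measurable_gauss_kernel (D : set (R * R)) :
  measurable_fun D (fun z => K z.1 z.2).
Proof.
apply: measurable_funTS; apply: measurableT_comp => //.
apply: measurableT_comp => //.
by apply: measurable_funM; apply: measurable_funX;
  [exact: measurable_fst|exact: measurable_snd].
Qed.

Lemma measurable_gauss_kernelr (D : set R) x : measurable_fun D (K x).
Proof.
apply: measurable_funTS.
exact: (measurableT_comp (measurable_gauss_kernel (D := setT))
  (measurable_pair1 x)).
Qed.

Lemma integral_gauss_kernelM x u : 0 < x -> 0 < u ->
  (\int[mu]_(y in P) (K x y * K u y)%:E)%E =
  (Num.sqrt pi / 2 / Num.sqrt (u ^+ 2 + x ^+ 2))%:E.
Proof.
move=> x0 u0; have xu0 : 0 < u ^+ 2 + x ^+ 2 by rewrite addr_gt0// exprn_gt0.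
rewrite -integral0y_gauss_scale ?sqrtr_gt0//; apply: eq_integral => y _.
rewrite /gauss_kernel -expRD exprMn sqr_sqrtr ?ltW//.
by congr (expR _)%:E; ring.
Qed.

(** Measurability is recovered from the convergence hypothesis: at [y = 1] the Gaussian factor is
    undone by multiplying with [expR (x ^+ 2)]. *)
Lemma measurable_of_L2_integrand f : abs_convergent (L2_integrand f 1) ->
  measurable_fun P (fun x => x * f x).
Proof.
move=> /measurable_int/measurable_EFinP mf.
apply: (@eq_measurable_fun _ _ _ _ _
    (fun x => L2_integrand f 1 x * expR (x ^+ 2))).
  move=> x _; rewrite L2_integrandE /gauss_kernel expr1n mulr1 -mulrA -expRD.
  by rewrite addNr expR0 mulr1.
apply: measurable_funM => //; apply: measurable_funTS.
by apply: measurableT_comp => //; exact: measurable_funX.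
Qed.

Lemma measurable_comp_fst h :
  measurable_fun P h -> measurable_fun (P `*` P) (fun z => h z.1).
Proof.
move=> mh; apply: (measurable_comp (measurable_itv `]0, +oo[) _ mh).
  by move=> _ [z [? _] <-].
by apply: measurable_funTS; exact: measurable_fst.
Qed.

Lemma measurable_comp_snd h :
  measurable_fun P h -> measurable_fun (P `*` P) (fun z => h z.2).
Proof.
move=> mh; apply: (measurable_comp (measurable_itv `]0, +oo[) _ mh).
  by move=> _ [z [_ ?] <-].
by apply: measurable_funTS; exact: measurable_snd.
Qed.

Lemma measurable_L2_integrand f : abs_convergent (L2_integrand f 1) ->
  measurable_fun (P `*` P) (fun z => L2_integrand f z.2 z.1).
Proof.
move=> hf; apply: (@eq_measurable_fun _ _ _ _ _
    (fun z : R * R => z.1 * f z.1 * K z.1 z.2)).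
  by move=> z _; rewrite L2_integrandE.
apply: measurable_funM; last exact: measurable_gauss_kernel.
exact: (measurable_comp_fst (measurable_of_L2_integrand hf)).
Qed.

(** * From the L2-transform to the Glasser transform *)

Lemma L2_transform_glasser g x : 0 < x ->
  (forall y, 0 < y -> abs_convergent (L2_integrand g y)) ->
  abs_convergent (glasser_integrand (fun u => u * g u) x) ->
  abs_convergent (fun y => K x y * L2_transform g y) /\
  \int[mu]_(y in P) (K x y * L2_transform g y) =
  Num.sqrt pi / 2 * glasser_transform (fun u => u * g u) x.
Proof.
move=> x0 hL2 hG; have mP : measurable P := measurable_itv `]0, +oo[.
have P0 z : P z -> 0 < z by rewrite /= in_itv/= andbT.
have iKK u : P u -> mu.-integrable P (EFin \o fun y => K x y * K u y).
  move=> /P0 u0; apply/integrableP; split.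
    apply/measurable_EFinP.
    by apply: measurable_funM; exact: measurable_gauss_kernelr.
  under eq_integral do rewrite /= ger0_norm ?mulr_ge0 ?ltW ?gauss_kernel_gt0//.
  by rewrite integral_gauss_kernelM ?ltry.
have KKE u : P u -> \int[mu]_(y in P) (K x y * K u y) =
    Num.sqrt pi / 2 / Num.sqrt (u ^+ 2 + x ^+ 2).
  by move=> /P0 u0; rewrite /Rintegral integral_gauss_kernelM.
have mK : measurable_fun (P `*` P) (fun z => K x z.1 * L2_integrand g z.1 z.2).
  apply: measurable_funM.
    by apply: measurable_comp_fst; exact: measurable_gauss_kernelr.
  (* The pair here is (parameter, integration variable), the reverse of [measurable_L2_integrand],
     hence the swap. *)
  apply: (@measurable_comp _ _ _ _ _ _ (P `*` P)
    (fun z : R * R => L2_integrand g z.2 z.1) _ (fun z : R * R => (z.2, z.1))).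
  - exact: measurableX.
  - by move=> _ [z [? ?] <-].
  - exact: (measurable_L2_integrand (hL2 _ ltr01)).
  - by apply: measurable_funTS; exact: measurable_swap.
have [] := @Rintegral_Fubini _ _ _ _ R mu mu P P
  (fun y u => K x y * L2_integrand g y u) mP mP.
- exact: mK.
- move=> y /P0 y0; apply: integrable_EFinZl => //; exact: hL2.
- move=> u Pu.
  rewrite (_ : (fun y => _) = fun y => u * g u * (K x y * K u y)).
    by apply: integrable_EFinZl => //; exact: iKK.
  by apply/funext => y; rewrite L2_integrandE; ring.
(* The kernels are positive, so integrating the absolute value over [y] gives exactly the absolute
   value of this multiple of the Glasser integrand, which is integrable by [hG]. *)
- have /integrableP[_] : mu.-integrable P (EFin \o fun u => Num.sqrt pi / 2 *
      glasser_integrand (fun u => u * g u) x u).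
    exact: integrable_EFinZl.
  apply: le_lt_trans.
  rewrite le_eqVlt; apply/orP; left; apply/eqP; apply: eq_integral => u /set_mem Pu.
  transitivity (\int[mu]_(y in P) (`|u * g u|%:E * (K x y * K u y)%:E))%E.
    apply: eq_integral => y _.
    rewrite -EFinM L2_integrandE mulrCA normrM; congr (_ * _)%:E.
    by rewrite ger0_norm// mulr_ge0// ltW// gauss_kernel_gt0.
  rewrite integralZl//; last exact: iKK.
  rewrite -EFin_Rintegral//; last exact: iKK.
  rewrite KKE// /= -EFinM; congr EFin; rewrite /glasser_integrand.
  have /ger0_norm <- : 0 <= Num.sqrt pi / 2 / Num.sqrt (u ^+ 2 + x ^+ 2).
    by rewrite !divr_ge0// sqrtr_ge0.
  by rewrite -normrM; congr Num.norm; ring.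
have E y : P y -> \int[mu]_(u in P) (K x y * L2_integrand g y u) =
    K x y * L2_transform g y.
  by move=> /P0 y0; rewrite RintegralZl//; exact: hL2.
move=> iKL swap; split.
  by apply: eq_integrable iKL => // y /set_mem Py; rewrite /= E.
rewrite -RintegralZl//.
transitivity (\int[mu]_(y in P) \int[mu]_(u in P) (K x y * L2_integrand g y u)).
  by apply: eq_Rintegral => y /set_mem Py; rewrite E.
rewrite swap; apply: eq_Rintegral => u /set_mem Pu.
transitivity (\int[mu]_(y in P) ((u * g u) * (K x y * K u y))).
  by apply: eq_Rintegral => y _; rewrite L2_integrandE; ring.
by rewrite RintegralZl ?KKE ?iKK// /glasser_integrand; ring.
Qed.

(** * Absolute values and measurability of the L2-transform *)

Lemma L2_transform_norm f y : 0 < y ->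
  L2_transform (fun x => `|f x|) y = \int[mu]_(x in P) `|L2_integrand f y x|.
Proof.
move=> y0; apply: eq_Rintegral => x /set_mem/=; rewrite in_itv/= andbT => x0.
rewrite /L2_integrand !normrM; congr (_ * _).
by rewrite gtr0_norm// gtr0_norm// expR_gt0.
Qed.

(* Fubini makes [K 1 y * L2_transform g y] integrable in [y], hence measurable,
   and the factor [K 1 y] can be divided out. *)
Lemma measurable_L2_transform g :
  (forall y, 0 < y -> abs_convergent (L2_integrand g y)) ->
  abs_convergent (glasser_integrand (fun u => u * g u) 1) ->
  measurable_fun P (L2_transform g).
Proof.
move=> hg hG.
have [/measurable_int/measurable_EFinP mKg _] :=
  L2_transform_glasser ltr01 hg hG.
apply: (@eq_measurable_fun _ _ _ _ _
    (fun y => K 1 y * L2_transform g y * expR (y ^+ 2))).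
  move=> y _; rewrite /gauss_kernel expr1n mul1r mulrAC -expRD addNr expR0.
  by rewrite mul1r.
apply: measurable_funM => //; apply: measurable_funTS.
by apply: measurableT_comp => //; exact: measurable_funX.
Qed.

(** Both integrands have positive factors besides [f], so [|f|] inherits the two convergence
    hypotheses. *)
Lemma measurable_L2_transform_norm f :
  (forall y, 0 < y -> abs_convergent (L2_integrand f y)) ->
  abs_convergent (glasser_integrand (fun u => u * f u) 1) ->
  measurable_fun P (L2_transform (fun x => `|f x|)).
Proof.
move=> hf hG; apply: measurable_L2_transform => [y y0|].
  apply: eq_integrable (integrable_norm (hf y y0)) => // x /set_mem/=.
  rewrite in_itv/= andbT => x0; congr EFin; rewrite !normrM.
  by rewrite gtr0_norm// gtr0_norm// expR_gt0.
apply: eq_integrable (integrable_norm hG) => // x /set_mem/=.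
rewrite in_itv/= andbT => x0; congr EFin; rewrite !normrM gtr0_norm//.
by rewrite (ger0_norm (_ : 0 <= (Num.sqrt _)^-1)) ?invr_ge0 ?sqrtr_ge0.
Qed.

(** * The Parseval-Goldstein relations *)

Lemma half_sqrtpi_neq0 : Num.sqrt pi / 2 != 0 :> R.
Proof. by rewrite gt_eqF// divr_gt0// sqrtr_gt0 pi_gt0. Qed.

(** The Glasser hypothesis on [g] at every [x] evaluates the inner [y]-integral; the one on [f] at
    [1] gives measurability of the L2-transform of [|f|], which the domination argument requires. *)
Lemma parseval_goldstein f g :
  (forall y, 0 < y -> abs_convergent (L2_integrand f y)) ->
  (forall y, 0 < y -> abs_convergent (L2_integrand g y)) ->
  (forall x, 0 < x -> abs_convergent (glasser_integrand (fun u => u * g u) x)) ->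
  abs_convergent (glasser_integrand (fun x => x * f x) 1) ->
  abs_convergent (fun y =>
    L2_transform (fun x => `|f x|) y * L2_transform (fun u => `|g u|) y) ->
  \int[mu]_(y in P) (L2_transform f y * L2_transform g y) =
  Num.sqrt pi / 2 *
  \int[mu]_(x in P) (x * f x * glasser_transform (fun u => u * g u) x).
Proof.
move=> hf hg hG hGf hfg; have mP : measurable P := measurable_itv `]0, +oo[.
have P0 z : P z -> 0 < z by rewrite /= in_itv/= andbT.
have mB := measurable_L2_transform hg (hG _ ltr01).
have mFB : measurable_fun (P `*` P)
    (fun z => L2_integrand f z.2 z.1 * L2_transform g z.2).
  apply: measurable_funM; last exact: measurable_comp_snd.
  exact: (measurable_L2_integrand (hf _ ltr01)).
have FBE x y : L2_integrand f y x * L2_transform g y =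
    x * f x * (K x y * L2_transform g y).
  by rewrite L2_integrandE mulrA.
have [] := @Rintegral_Fubini _ _ _ _ R mu mu P P
  (fun x y => L2_integrand f y x * L2_transform g y) mP mP.
- exact: mFB.
- move=> x /P0 x0.
  rewrite (_ : (fun y => _) = fun y => x * f x * (K x y * L2_transform g y)).
    apply: integrable_EFinZl => //.
    exact: (L2_transform_glasser x0 hg (hG _ x0)).1.
  by apply/funext => y; exact: FBE.
- move=> y /P0 y0.
  rewrite (_ : (fun x => _) = fun x => L2_transform g y * L2_integrand f y x).
    by apply: integrable_EFinZl => //; exact: hf.
  by apply/funext => x; rewrite mulrC.
(* The inner integral of the absolute value is the L2-transform of [|f|] times the modulus of that
   of [g]. The latter is at most the L2-transform of [|g|], so [hfg] supplies an integrable
   majorant. *)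
- move/integrableP : (hfg) => [_]; apply: le_lt_trans.
  have LE y : P y ->
      (\int[mu]_(x in P) `|L2_integrand f y x * L2_transform g y|%:E)%E =
      (L2_transform (fun x => `|f x|) y * `|L2_transform g y|)%:E.
    move=> /P0 y0; rewrite L2_transform_norm// mulrC.
    have iN : mu.-integrable P (EFin \o fun x => `|L2_integrand f y x|).
      exact: integrable_norm (hf _ y0).
    rewrite -RintegralZl// EFin_Rintegral//; last exact: integrable_EFinZl.
    by apply: eq_integral => x _; rewrite normrM mulrC.
  under eq_integral => y /set_mem Py do rewrite LE//.
  have L0 h y : 0 <= L2_transform (fun x => `|h x|) y.
    apply: Rintegral_ge0 => x /P0 x0.
    by rewrite !mulr_ge0 ?expR_ge0// ltW.
  apply: ge0_le_integral => //.
  - by move=> y _; rewrite lee_fin mulr_ge0.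
  - apply/measurable_EFinP; apply: measurable_funM; last exact: measurableT_comp.
    exact: measurable_L2_transform_norm.
  - by apply: measurableT_comp => //; exact: measurable_int hfg.
  - move=> y /P0 y0; rewrite lee_fin ger0_norm ?mulr_ge0//.
    apply: ler_wpM2l => //; rewrite L2_transform_norm//.
    by apply: le_normr_Rintegral => //; exact: hg.
move=> iF swap.
have E x : P x ->
    \int[mu]_(y in P) (L2_integrand f y x * L2_transform g y) =
    Num.sqrt pi / 2 * (x * f x * glasser_transform (fun u => u * g u) x).
  move=> /P0 x0; have [iKg KgE] := L2_transform_glasser x0 hg (hG _ x0).
  under eq_Rintegral do rewrite FBE.
  by rewrite mulrCA -KgE; exact: RintegralZl iKg.
transitivity (\int[mu]_(x in P) \int[mu]_(y in P)
    (L2_integrand f y x * L2_transform g y)).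
  rewrite swap; apply: eq_Rintegral => y /set_mem/P0 y0.
  by symmetry; apply: RintegralZr (hf _ y0).
transitivity (\int[mu]_(x in P) (Num.sqrt pi / 2 *
    (x * f x * glasser_transform (fun u => u * g u) x))).
  by apply: eq_Rintegral => x /set_mem; exact: E.
apply: RintegralZl; first exact: measurable_itv.
(* Extracting the constant needs integrability of [x * f x] times the Glasser transform; this is
   [iF] divided by the nonzero constant [Num.sqrt pi / 2]. *)
apply: (@eq_integrable _ _ _ mu _ _ (EFin \o fun x : R =>
    (Num.sqrt pi / 2)^-1 *
    \int[mu]_(y in P) (L2_integrand f y x * L2_transform g y))).
- exact: measurable_itv.
- move=> x /set_mem Px; congr EFin; rewrite (E _ Px); exact: mulKf half_sqrtpi_neq0 _.
- by apply: integrable_EFinZl; first exact: measurable_itv.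
Qed.
End parseval_goldstein.

(* The iterated integrals converge absolutely in the sense that they converge
   when f and g are replaced by their absolute values. *)
Theorem theorem5 (R : realType) (f g : R -> R)
  (hL2f : forall y : R, 0 < y -> abs_convergent (L2_integrand f y))
  (hL2g : forall y : R, 0 < y -> abs_convergent (L2_integrand g y))
  (hGg : forall x : R, 0 < x ->
    abs_convergent (glasser_integrand (fun u => u * g u) x))
  (hGf : forall u : R, 0 < u ->
    abs_convergent (glasser_integrand (fun x => x * f x) u))
  (hL2L2 : abs_convergent (fun y =>
    L2_transform (fun x => `|f x|) y * L2_transform (fun u => `|g u|) y))
  (hfG : abs_convergent (fun x =>
    x * `|f x| * glasser_transform (fun u => u * `|g u|) x))
  (hgG : abs_convergent (fun u =>
    u * `|g u| * glasser_transform (fun x => x * `|f x|) u)) :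
  [/\ \int[@lebesgue_measure R]_(y in `]0, +oo[)
        (L2_transform f y * L2_transform g y) =
      Num.sqrt pi / 2 *
      \int[@lebesgue_measure R]_(x in `]0, +oo[)
        (x * f x * glasser_transform (fun u => u * g u) x),
      \int[@lebesgue_measure R]_(y in `]0, +oo[)
        (L2_transform f y * L2_transform g y) =
      Num.sqrt pi / 2 *
      \int[@lebesgue_measure R]_(u in `]0, +oo[)
        (u * g u * glasser_transform (fun x => x * f x) u)
    & \int[@lebesgue_measure R]_(x in `]0, +oo[)
        (x * f x * glasser_transform (fun u => u * g u) x) =
      \int[@lebesgue_measure R]_(u in `]0, +oo[)
        (u * g u * glasser_transform (fun x => x * f x) u)].
Proof.
have eq1 := parseval_goldstein hL2f hL2g hGg (hGf _ ltr01) hL2L2.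
have eq2 := @parseval_goldstein R g f hL2g hL2f hGf (hGg _ ltr01).
have {}eq2 : \int[@lebesgue_measure R]_(y in `]0, +oo[)
    (L2_transform f y * L2_transform g y) = Num.sqrt pi / 2 *
    \int[@lebesgue_measure R]_(u in `]0, +oo[)
      (u * g u * glasser_transform (fun x => x * f x) u).
  rewrite -eq2; first by apply: eq_Rintegral => y _; rewrite mulrC.
  by apply: eq_integrable hL2L2 => // y _; rewrite /= mulrC.
split; [exact: eq1|exact: eq2|].
(* The first two identities share their left side, so the common nonzero factor cancels. *)
exact: mulfI (half_sqrtpi_neq0 R) _ _ (etrans (esym eq1) eq2).
Qed.
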